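(* For every positive integer $n$ and every $z \in \mathbb{C} \setminus \big(\{-1,-2,-3,\ldots\} \cup \{0,1,\ldots,n-2\}\big)$ we have $$A(z) = (-1)^{n} \Big( A(z - n) + \big((-1)^{n} - q_{n}(z)\big)\, \Gamma(z+2)\Big)$$ and $$A(z) = (-1)^{n} \Big( A(z - n) + r_{n}(z)\, \Gamma(z+2)\Big).$$
   Context: The alternating Kurepa function $A$ is defined for $\operatorname{Re} z > 0$ by $$A(z)=\int_0^\infty e^{-t}\,\frac{t^{z+1}-(-1)^{z}t}{t+1}\,dt,\qquad (-1)^z = e^{i\pi z},$$ and is extended to a meromorphic function on $\mathbb{C}$ by the functional equation $A(z)+A(z-1)=\Gamma(z+1)$; it has simple poles exactly at the integers $z=-m$ with $m\ge 2$. The rational functions $q_n(z)$ and $r_n(z)$ (defined for $z\in\mathbb{C}\setminus\{-1,0,1,\ldots,n-2\}$, this set being $\{-1\}$ for $n=1$) are given by the initial functions $$q_1(z)=-\frac{z}{z+1},\quad q_2(z)=\frac{z^2+1}{z(z+1)},\qquad r_1(z)=-\frac{1}{z+1},\quad r_2(z)=\frac{z-1}{z(z+1)},$$ and, for $n\ge 3$, by the recurrences $$q_n(z)=-\frac{z-n+1}{z-n+2}\,q_{n-1}(z)+\frac{1}{z-n+2}\,q_{n-2}(z),\qquad r_n(z)=-\frac{z-n+1}{z-n+2}\,r_{n-1}(z)+\frac{1}{z-n+2}\,r_{n-2}(z).$$ *)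

(* Defs.v *)
From Stdlib Require Import Reals ZArith.
From Coquelicot Require Import Coquelicot.

Open Scope C_scope.

Definition Cexp (z : C) : C :=
  (exp (Re z) * cos (Im z), exp (Re z) * sin (Im z))%R.

(** [t ^ z = e ^ (z ln t)], meaningful for [0 < t]. *)
Definition RCpower (t : R) (z : C) : C := Cexp (z * RtoC (ln t)).

(** The branch [(-1) ^ z = e ^ (i pi z)]. *)
Definition m1_power (z : C) : C := Cexp (Ci * RtoC PI * z).

Definition CInt_0_infty (f : R -> C) : C :=
  RInt_gen (V := C_R_CompleteNormedModule) f
    (at_right 0%R) (Rbar_locally p_infty).

(** The least [N : nat] with [0 < Re z + N]: it is [0] when [0 < Re z], and
    otherwise the integer [up (- Re z)], i.e. the least one above [- Re z]. *)
Definition shift_right (z : C) : nat := Z.to_nat (up (- Re z)).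

(** Euler's integral, meaningful for [0 < Re z]. *)
Definition Gamma_int (z : C) : C :=
  CInt_0_infty (fun t => RtoC (exp (- t)) * RCpower t (z - 1)).

Fixpoint Gamma_ext (N : nat) (z : C) : C :=
  match N with
  | O => Gamma_int z
  | S N' => Gamma_ext N' (z + 1) / z
  end.

(** The meromorphic Gamma function, continued to [Re z <= 0] by
    [Gamma z = Gamma (z + 1) / z].  The value at the poles [0, -1, -2, ...] is
    a meaningless default. *)
Definition Gamma (z : C) : C := Gamma_ext (shift_right z) z.

(** The integral representation used for [0 < Re z]. *)
Definition altKurepa_int (z : C) : C :=
  CInt_0_infty (fun t =>
    RtoC (exp (- t)) *
      ((RCpower t (z + 1) - m1_power z * RtoC t) / (RtoC t + 1))).

Fixpoint altKurepa_ext (N : nat) (z : C) : C :=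
  match N with
  | O => altKurepa_int z
  | S N' => Gamma (z + 2) - altKurepa_ext N' (z + 1)
  end.

(** The alternating Kurepa function, continued to [Re z <= 0] by the functional
    equation [A w + A (w - 1) = Gamma (w + 1)] at [w = z + 1].  The value at the
    poles [-2, -3, ...] is a meaningless default. *)
Definition altKurepa (z : C) : C := altKurepa_ext (shift_right z) z.

(** [q_n] and [r_n] are indexed from [n = 1]; index [0] is a dummy. *)
Fixpoint q (n : nat) (z : C) {struct n} : C :=
  match n with
  | O => 0
  | S O => - (z / (z + 1))
  | S (S O) => (z ^ 2 + 1) / (z * (z + 1))
  | S ((S n2) as n1) =>
      - ((z - RtoC (INR n) + 1) / (z - RtoC (INR n) + 2)) * q n1 z
      + 1 / (z - RtoC (INR n) + 2) * q n2 z
  end.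

Fixpoint r (n : nat) (z : C) {struct n} : C :=
  match n with
  | O => 0
  | S O => - (1 / (z + 1))
  | S (S O) => (z - 1) / (z * (z + 1))
  | S ((S n2) as n1) =>
      - ((z - RtoC (INR n) + 1) / (z - RtoC (INR n) + 2)) * r n1 z
      + 1 / (z - RtoC (INR n) + 2) * r n2 z
  end.

(* Main.v *)
Require Import Defs.
From Stdlib Require Import Reals ZArith Lra Lia.
From Coquelicot Require Import Coquelicot.

(** The alternating Kurepa function satisfies
    [altKurepa (w + 1) + altKurepa w = Gamma (w + 2)] for every [w].  Stepping
    [n] times to the left from [z] therefore gives
    [altKurepa z = (-1)^n (altKurepa (z - n) + c_n)], where [c_n] is an
    alternating sum of values of [Gamma] that obeys
    [c_(n+1) + c_n = - Gamma (z - n + 1)].  Each of these values is a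
    rational multiple of [Gamma (z + 2)], because [Gamma (s + 1) = s * Gamma s]
    can be used at [s = z + 1, z, ..., z - n + 1] as long as none of these vanishes.  So
    [c_n = r_n(z) * Gamma (z + 2)], where
    [r_(n+1) + r_n = - Gamma (z - n + 1) / Gamma (z + 2)], and the three-term
    recurrence of [r_n] is exactly what makes the sums [r_(n+1) + r_n] have
    these values: it says that
    [r_(n+1) + r_n = (r_n + r_(n-1)) / (z - n + 1)]
    ([r_succ_plus_r_Gamma], [altKurepa_reduction]).  The sequence [(-1)^n]
    solves the same linear recurrence, so [q_n + r_n = (-1)^n] follows from the
    first two values ([q_plus_r]), and the two forms of the claim agree.

    The rest is analysis: the two functional equations.  In the closed left
    half-plane they hold by construction of the continuations.  In the right
    half-plane they are statements about convergent integrals.  For [Gamma]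
    this is integration by parts ([Gamma_int_plus_1]).  For [altKurepa], the
    sign change [(-1)^(z+1) = - (-1)^z] cancels the correction terms when two
    consecutive integrands are added, and the rest has the factor [t + 1] that
    cancels the denominator ([altKurepa_int_functional]).  Both need the
    integrals to converge, which follows from a comparison with an integrand
    whose primitive is explicit ([ex_RInt_gen_weighted_RCpower]). *)

Open Scope R_scope.

(** * Convergence of dominated improper integrals *)

Lemma minus_plus_cancel_mid (G : AbelianGroup) (x y w : G) :
  minus (plus x (plus y w)) y = plus x w.
Proof.
  unfold minus; rewrite (plus_comm y w), <- !plus_assoc.
  apply f_equal.
  transitivity (plus w zero); [apply f_equal, plus_opp_r | apply plus_zero_r].
Qed.

Lemma norm_RInt_le_primitive (V : CompleteNormedModule R_AbsRing)
  (f : R -> V) (G g : R -> R) (a b : R) :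
  0 < a -> 0 < b ->
  (forall t, 0 < t -> continuous f t) ->
  (forall t, 0 < t -> is_derive G t (g t)) ->
  (forall t, 0 < t -> continuous g t) ->
  (forall t, 0 < t -> norm (f t) <= g t) ->
  norm (RInt f a b) <= Rabs (G b - G a).
Proof.
  intros Ha Hb Cf DG Cg Hle.
  assert (main : forall a b, 0 < a -> a <= b ->
            norm (RInt f a b) <= Rabs (G b - G a)).
  { clear a b Ha Hb; intros a b Ha Hab.
    apply Rle_trans with (G b - G a); [| apply Rle_abs].
    apply (norm_RInt_le f g a b).
    - exact Hab.
    - intros x Hx; apply Hle; lra.
    - apply RInt_correct, ex_RInt_continuous; intros x Hx.
      rewrite Rmin_left in Hx by lra; apply Cf; lra.
    - apply (is_RInt_derive G g); rewrite Rmin_left by lra; intros x Hx.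
      + apply DG; lra.
      + apply Cg; lra. }
  destruct (Rle_dec a b) as [Hab | Hab].
  - now apply main.
  - rewrite <- opp_RInt_swap, Rabs_minus_sym.
    + eapply Rle_trans;
        [apply Req_le, (norm_opp (V := CompleteNormedModule.NormedModule _ V))
        | apply main; lra].
    + apply ex_RInt_continuous; intros x Hx; apply Cf.
      rewrite Rmin_left in Hx by lra; lra.
Qed.

Lemma filter_prod_pos :
  filter_prod (at_right 0) (Rbar_locally p_infty)
    (fun ab : R * R => 0 < fst ab /\ 0 < snd ab).
Proof.
  exists (fun a => 0 < a) (fun b => 0 < b).
  - exists (mkposreal 1 Rlt_0_1); intros a _ Ha; exact Ha.
  - exists 0; intros b Hb; exact Hb.
  - intros a b Ha Hb; now split.
Qed.

(** The Cauchy criterion: when both endpoints move, the integral changes by two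
    pieces, and [norm_RInt_le_primitive] bounds each by the increment of [G] on
    it, which is small because [G] converges at both ends. *)
Lemma ex_RInt_gen_dominated (V : CompleteNormedModule R_AbsRing)
  (f : R -> V) (G g : R -> R) (la lb : R) :
  (forall t, 0 < t -> continuous f t) ->
  (forall t, 0 < t -> is_derive G t (g t)) ->
  (forall t, 0 < t -> continuous g t) ->
  (forall t, 0 < t -> norm (f t) <= g t) ->
  filterlim G (at_right 0) (locally la) ->
  filterlim G (Rbar_locally p_infty) (locally lb) ->
  ex_RInt_gen f (at_right 0) (Rbar_locally p_infty).
Proof.
  intros Cf DG Cg Hle La Lb.
  assert (If : forall a b, 0 < a -> 0 < b -> ex_RInt f a b).
  { intros a b Ha Hb; apply ex_RInt_continuous; intros x Hx; apply Cf.
    assert (0 < Rmin a b) by (apply Rmin_case; assumption); lra. }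
  assert (Hpos0 : at_right 0 (fun a => 0 < a)).
  { exists (mkposreal 1 Rlt_0_1); intros a _ Ha; exact Ha. }
  assert (Hposp : Rbar_locally p_infty (fun b => 0 < b)).
  { exists 0; intros b Hb; exact Hb. }
  assert (HF : ProperFilter (filter_prod (at_right 0) (Rbar_locally p_infty))).
  { apply filter_prod_proper. }
  assert (HC : exists l, filterlim (fun ab : R * R => RInt f (fst ab) (snd ab))
            (filter_prod (at_right 0) (Rbar_locally p_infty)) (locally l)).
  { apply filterlim_locally_cauchy; intros eps.
    assert (He : 0 < eps / 4) by (destruct eps; simpl; lra).
    set (e := mkposreal _ He).
    exists (fun ab => (0 < fst ab /\ ball la e (G (fst ab)))
                      /\ (0 < snd ab /\ ball lb e (G (snd ab)))).
    split.
    { exists (fun a => 0 < a /\ ball la e (G a)) (fun b => 0 < b /\ ball lb e (G b)).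
      - apply filter_and; [exact Hpos0 |]. apply La; exists e; now intros.
      - apply filter_and; [exact Hposp |]. apply Lb; exists e; now intros.
      - intros x y Hx Hy; now split. }
    intros [a b] [a' b'] [[Ha Ea] [Hb Eb]] [[Ha' Ea'] [Hb' Eb']]; simpl in *.
    apply (norm_compat1 (V := CompleteNormedModule.NormedModule _ V)).
    assert (Hdec : minus (RInt f a' b') (RInt f a b)
              = plus (RInt f a' a) (RInt f b b')).
    { rewrite <- (RInt_Chasles f a' a b') by auto.
      rewrite <- (RInt_Chasles f a b b') by auto.
      apply minus_plus_cancel_mid. }
    apply (f_equal (norm (V := CompleteNormedModule.NormedModule _ V))) in Hdec.
    eapply Rle_lt_trans; [apply Req_le, Hdec |].
    eapply Rle_lt_trans;
      [apply (norm_triangle (V := CompleteNormedModule.NormedModule _ V)) |].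
    assert (B1 := norm_RInt_le_primitive V f G g a' a Ha' Ha Cf DG Cg Hle).
    assert (B2 := norm_RInt_le_primitive V f G g b b' Hb Hb' Cf DG Cg Hle).
    change (Rabs (G a - la) < eps / 4) in Ea.
    change (Rabs (G a' - la) < eps / 4) in Ea'.
    change (Rabs (G b - lb) < eps / 4) in Eb.
    change (Rabs (G b' - lb) < eps / 4) in Eb'.
    apply Rabs_def2 in Ea; apply Rabs_def2 in Ea';
    apply Rabs_def2 in Eb; apply Rabs_def2 in Eb'.
    assert (Rabs (G a - G a') < eps / 2) by (apply Rabs_def1; lra).
    assert (Rabs (G b' - G b) < eps / 2) by (apply Rabs_def1; lra).
    lra. }
  destruct HC as [l Hl]; exists l.
  apply (filterlimi_lim_ext_loc (fun ab : R * R => RInt f (fst ab) (snd ab))).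
  - exists (fun a => 0 < a) (fun b => 0 < b); auto.
    intros a b Ha Hb; apply RInt_correct, If; assumption.
  - exact Hl.
Qed.

(** * Powers against the exponential *)

Lemma filterlim_Rpower_0 (s : R) : 0 < s ->
  filterlim (fun t => exp (s * ln t)) (at_right 0) (locally 0).
Proof.
  intros Hs.
  apply (filterlim_comp _ _ _ (fun t => s * ln t) exp _ (Rbar_locally m_infty)).
  - apply (filterlim_comp _ _ _ ln (fun u => s * u) _ (Rbar_locally m_infty)).
    + exact is_lim_ln_0.
    + assert (H := filterlim_Rbar_mult_l s m_infty).
      replace (Rbar_mult s m_infty) with m_infty in H; [exact H |].
      simpl; destruct (Rle_dec 0 s) as [h | h]; [| lra].
      destruct (Rle_lt_or_eq_dec 0 s h); [easy | lra].
  - exact is_lim_exp_m.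
Qed.

Lemma filterlim_Rpower_p (s : R) : 0 < s ->
  filterlim (fun t => exp (s * ln t)) (Rbar_locally p_infty) (Rbar_locally p_infty).
Proof.
  intros Hs.
  apply (filterlim_comp _ _ _ (fun t => s * ln t) exp _ (Rbar_locally p_infty)).
  - apply (filterlim_comp _ _ _ ln (fun u => s * u) _ (Rbar_locally p_infty)).
    + exact is_lim_ln_p.
    + assert (H := filterlim_Rbar_mult_l s p_infty).
      replace (Rbar_mult s p_infty) with p_infty in H; [exact H |].
      simpl; destruct (Rle_dec 0 s) as [h | h]; [| lra].
      destruct (Rle_lt_or_eq_dec 0 s h); [easy | lra].
  - exact is_lim_exp_p.
Qed.

(** The maximum of [t^a e^(-t)] is at [t = a]; the bound is the inequality
    [ln u <= u - 1] at [u = t / a]. *)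
Lemma exp_neg_Rpower_bounded (a t : R) : 0 < a -> 0 < t ->
  exp (- t) * exp (a * ln t) <= exp (a * ln a - a).
Proof.
  intros Ha Ht; rewrite <- exp_plus.
  assert (Hta : 0 < t / a) by (apply Rdiv_lt_0_compat; assumption).
  assert (Hln : ln (t / a) <= t / a - 1).
  { assert (H := exp_ineq1_le (ln (t / a))); rewrite exp_ln in H; lra. }
  unfold Rdiv at 1 in Hln.
  rewrite ln_mult, ln_Rinv in Hln by (auto with real).
  assert (Hm : a * (ln t - ln a) <= a * (t / a - 1)).
  { apply Rmult_le_compat_l; lra. }
  replace (a * (t / a - 1)) with (t - a) in Hm by (field; lra).
  destruct (Rle_lt_or_eq_dec (- t + a * ln t) (a * ln a - a)) as [h | h].
  - lra.
  - left; now apply exp_increasing.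
  - rewrite h; apply Rle_refl.
Qed.

(** * Complex powers and convergence of the integrals *)

Lemma RCpower_polar (t : R) (z : C) :
  RCpower t z = (exp (Re z * ln t) * cos (Im z * ln t),
                 exp (Re z * ln t) * sin (Im z * ln t)).
Proof.
  unfold RCpower, Cexp; destruct z as [x y]; simpl.
  now rewrite !Rmult_0_r, Rminus_0_r, Rplus_0_l.
Qed.

Lemma Cmod_RCpower (t : R) (z : C) : Cmod (RCpower t z) = exp (Re z * ln t).
Proof.
  rewrite RCpower_polar; unfold Cmod; simpl fst; simpl snd.
  set (u := exp _); set (v := Im z * ln t).
  replace ((u * cos v) ^ 2 + (u * sin v) ^ 2) with (u ^ 2).
  - apply sqrt_pow2; left; apply exp_pos.
  - assert (H := sin2_cos2 v); unfold Rsqr in H.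
    transitivity (u ^ 2 * (sin v * sin v + cos v * cos v)); [rewrite H | ]; ring.
Qed.

Lemma continuous_C_pair (u v : R -> R) (t : R) :
  continuous u t -> continuous v t ->
  continuous (U := C_R_NormedModule) (fun t => (u t, v t) : C) t.
Proof.
  intros Cu Cv.
  apply (filterlim_comp_2 (G := locally (u t)) (H := locally (v t)) u v);
    [exact Cu | exact Cv |].
  intros P [eps HP].
  exists (ball (u t) eps) (ball (v t) eps);
    [now exists eps | now exists eps |].
  intros x y Hx Hy; apply HP; now split.
Qed.

Lemma continuous_weighted_RCpower (k : R -> R) (z : C) (t : R) :
  0 < t -> continuous k t ->
  continuous (U := C_R_NormedModule) (fun t => (RtoC (k t) * RCpower t z)%C) t.
Proof.
  intros Ht Ck.
  assert (Hc : forall h : R -> R, ex_derive h t -> 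
     continuous (fun t => k t * h t) t).
  { intros h Dh; apply (continuous_mult k h); [exact Ck |].
    now apply (ex_derive_continuous (V := R_NormedModule)). }
  apply (continuous_ext (fun t =>
     (k t * (exp (Re z * ln t) * cos (Im z * ln t)),
      k t * (exp (Re z * ln t) * sin (Im z * ln t))) : C)).
  { intros u; rewrite RCpower_polar; unfold Cmult; simpl.
    f_equal; ring. }
  apply continuous_C_pair.
  - apply (Hc (fun t => exp (Re z * ln t) * cos (Im z * ln t))); auto_derive; lra.
  - apply (Hc (fun t => exp (Re z * ln t) * sin (Im z * ln t))); auto_derive; lra.
Qed.

(** With [x = Re s], the integrand is at most [e^(-t) t^(x-1)].  A single
    comparison covers both ends of the half-line: [t^x / (1 + t^x)] goes from
    [0] to [1] and has derivative [x t^(x-1) / (1 + t^x)^2], and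
    [e^(-t) (1 + t^x)^2] is bounded. *)
Lemma ex_RInt_gen_weighted_RCpower (k : R -> R) (s : C) :
  0 < Re s ->
  (forall t, 0 < t -> continuous k t) ->
  (forall t, 0 < t -> Rabs (k t) <= exp (- t)) ->
  ex_RInt_gen (V := C_R_CompleteNormedModule)
    (fun t => (RtoC (k t) * RCpower t (s - 1))%C)
    (at_right 0) (Rbar_locally p_infty).
Proof.
  intros Hs Ck Hk; set (x := Re s) in *.
  set (M := exp (2 * x * ln (2 * x) - 2 * x)).
  set (K := 2 * (1 + M) / x).
  assert (HM : 0 < M) by apply exp_pos.
  (* [- K / (1 + t^x)] is [K t^x / (1 + t^x)] up to an additive constant; [M]
     bounds [e^(-t) t^(2 x)], so [K x] bounds [e^(-t) (1 + t^x)^2]. *)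
  apply (ex_RInt_gen_dominated C_R_CompleteNormedModule _
     (fun t => - K * / (1 + exp (x * ln t)))
     (fun t => K * x * exp (x * ln t) / t / (1 + exp (x * ln t)) ^ 2) 
     (- K) 0).
  - intros t Ht; apply continuous_weighted_RCpower; auto.
  - intros t Ht; assert (Hp := exp_pos (x * ln t)).
    auto_derive; [repeat split; lra |]. field; lra.
  - intros t Ht; assert (Hp := exp_pos (x * ln t)).
    apply (ex_derive_continuous (V := R_NormedModule)); auto_derive.
    repeat split; try lra.
    apply Rgt_not_eq, Rmult_gt_0_compat; lra.
  - intros t Ht.
    eapply Rle_trans; [apply Req_le; symmetry; apply Cmod_norm |].
    rewrite Cmod_mult, Cmod_R, Cmod_RCpower.
    replace (Re (s - 1)%C) with (x - 1) by (destruct s; unfold x; simpl; ring).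
    set (T := exp (x * ln t)).
    assert (HT : 0 < T) by apply exp_pos.
    replace (exp ((x - 1) * ln t)) with (T / t).
    2:{ replace ((x - 1) * ln t) with (x * ln t + - ln t) by ring.
        rewrite exp_plus, exp_Ropp, exp_ln by assumption; reflexivity. }
    assert (Hb : exp (- t) * (T * T) <= M).
    { unfold T; rewrite <- exp_plus.
      replace (x * ln t + x * ln t) with (2 * x * ln t) by ring.
      apply exp_neg_Rpower_bounded; lra. }
    assert (He : exp (- t) <= 1).
    { rewrite <- exp_0; left; apply exp_increasing; lra. }
    assert (He0 := exp_pos (- t)).
    assert (Hq : exp (- t) * (1 + T) ^ 2 <= 2 * (1 + M)).
    { assert (Hsq := pow2_ge_0 (1 - T)). nra. }
    apply Rle_trans with (exp (- t) * (T / t)).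
    { apply Rmult_le_compat_r; [| now apply Hk].
      left; now apply Rdiv_lt_0_compat. }
    replace (K * x * T / t / (1 + T) ^ 2) with (2 * (1 + M) * / (1 + T) ^ 2 * (T / t)).
    2:{ unfold K; field; repeat split; lra. }
    apply Rmult_le_compat_r; [left; now apply Rdiv_lt_0_compat |].
    apply Rmult_le_reg_r with ((1 + T) ^ 2); [apply pow_lt; lra |].
    rewrite Rmult_assoc, Rinv_l, Rmult_1_r; [exact Hq | apply pow_nonzero; lra].
  - assert (H : continuous (fun u => - K * / (1 + u)) 0).
    { apply (ex_derive_continuous (V := R_NormedModule)); auto_derive; lra. }
    unfold continuous in H; rewrite Rplus_0_r, Rinv_1, Rmult_1_r in H.
    apply (filterlim_comp _ _ _ (fun t => exp (x * ln t))
      (fun u => - K * / (1 + u)) _ (locally 0)).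
    + now apply filterlim_Rpower_0.
    + exact H.
  - apply (filterlim_comp _ _ _ (fun t => exp (x * ln t))
      (fun u => - K * / (1 + u)) _ (Rbar_locally p_infty)).
    + now apply filterlim_Rpower_p.
    + assert (L : is_lim (fun u => - K * / (1 + u)) p_infty 0).
      { evar_last.
        { apply is_lim_scal_l, is_lim_inv.
          - eapply is_lim_plus; [apply is_lim_const | apply is_lim_id | reflexivity].
          - easy. }
        simpl; f_equal; ring. }
      exact L.
Qed.

(** * Complex-valued integrals over the half-line *)

Definition is_CInt_0_infty (f : R -> C) (l : C) : Prop :=
  is_RInt_gen (V := C_R_NormedModule) f (at_right 0) (Rbar_locally p_infty) l.

Lemma CInt_0_infty_unique (f : R -> C) (l : C) :
  is_CInt_0_infty f l -> CInt_0_infty f = l.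
Proof.
  unfold is_CInt_0_infty, CInt_0_infty; intros H.
  exact (is_RInt_gen_unique (V := C_R_CompleteNormedModule) f l H).
Qed.

Lemma is_CInt_0_infty_ext (f g : R -> C) (l : C) :
  (forall t, 0 < t -> f t = g t) -> is_CInt_0_infty f l -> is_CInt_0_infty g l.
Proof.
  intros E; apply is_RInt_gen_ext.
  generalize filter_prod_pos; apply filter_imp; intros [a b] [Ha Hb] t Ht.
  apply E; simpl in *.
  assert (0 < Rmin a b) by (apply Rmin_case; assumption); lra.
Qed.

Lemma is_CInt_0_infty_plus (f g : R -> C) (lf lg : C) :
  is_CInt_0_infty f lf -> is_CInt_0_infty g lg ->
  is_CInt_0_infty (fun t => (f t + g t)%C) (lf + lg)%C.
Proof. intros Hf Hg; exact (is_RInt_gen_plus f g lf lg Hf Hg). Qed.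

Lemma is_RInt_Ci (f : R -> C) (a b : R) (l : C) :
  is_RInt (V := C_R_NormedModule) f a b l ->
  is_RInt (V := C_R_NormedModule) (fun t => (Ci * f t)%C) a b (Ci * l)%C.
Proof.
  intros H.
  assert (H1 := is_RInt_fct_extend_fst (U := R_NormedModule)
    (V := R_NormedModule) _ _ _ _ H).
  assert (H2 := is_RInt_fct_extend_snd (U := R_NormedModule)
    (V := R_NormedModule) _ _ _ _ H).
  apply (is_RInt_fct_extend_pair (U := R_NormedModule) (V := R_NormedModule)).
  - replace (fst Ci * fst l - snd Ci * snd l) with (- snd l) by (simpl; ring).
    apply is_RInt_ext with (fun t => - snd (f t)).
    + intros t _; simpl; ring.
    + exact (is_RInt_opp _ _ _ _ H2).
  - replace (fst Ci * snd l + snd Ci * fst l) with (fst l) by (simpl; ring).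
    apply is_RInt_ext with (fun t => fst (f t)).
    + intros t _; simpl; ring.
    + exact H1.
Qed.

(** Complex numbers carry here only the structure of a real normed space, so
    linearity over [C] is not automatic.  Multiplication by [Ci] swaps the two
    components up to sign, and hence preserves the balls of the product. *)
Lemma is_CInt_0_infty_Ci (f : R -> C) (l : C) :
  is_CInt_0_infty f l -> is_CInt_0_infty (fun t => (Ci * f t)%C) (Ci * l)%C.
Proof.
  intros H; apply filterlimi_locally; intros eps.
  generalize (proj1 (filterlimi_locally _ _) H eps).
  apply filter_imp; intros [a b] [y [Hy [B1 B2]]].
  exists (Ci * y)%C; split; [now apply is_RInt_Ci |].
  change (Rabs (fst y - fst l) < eps) in B1.
  change (Rabs (snd y - snd l) < eps) in B2.
  split.
  - change (Rabs ((0 * fst y - 1 * snd y) - (0 * fst l - 1 * snd l)) < eps).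
    rewrite <- Rabs_Ropp.
    now replace (- _) with (snd y - snd l) by ring.
  - change (Rabs ((0 * snd y + 1 * fst y) - (0 * snd l + 1 * fst l)) < eps).
    now replace (_ - _) with (fst y - fst l) by ring.
Qed.

Lemma is_CInt_0_infty_scal (c : C) (f : R -> C) (l : C) :
  is_CInt_0_infty f l -> is_CInt_0_infty (fun t => (c * f t)%C) (c * l)%C.
Proof.
  intros H.
  assert (Hr : forall (k : R) g lg, is_CInt_0_infty g lg ->
             is_CInt_0_infty (fun t => (RtoC k * g t)%C) (RtoC k * lg)%C).
  { intros k g lg Hg; rewrite <- scal_R_Cmult.
    apply (is_CInt_0_infty_ext (fun t => scal (V := C_R_ModuleSpace) k (g t))).
    - intros t _; apply scal_R_Cmult.
    - exact (is_RInt_gen_scal g k lg Hg). }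
  assert (E : forall w : C, (RtoC (Re c) * w + RtoC (Im c) * (Ci * w) = c * w)%C).
  { intros w; destruct c as [x y], w as [u v]; unfold Cmult, Cplus; simpl.
    f_equal; ring. }
  rewrite <- E.
  apply (is_CInt_0_infty_ext (fun t => (RtoC (Re c) * f t + RtoC (Im c) * (Ci * f t))%C)).
  - intros t _; apply E.
  - apply is_CInt_0_infty_plus; apply Hr; [exact H | now apply is_CInt_0_infty_Ci].
Qed.

(** * The functional equation of Gamma *)

Lemma RCpower_plus_1 (t : R) (s : C) : 0 < t ->
  RCpower t (s + 1) = (RtoC t * RCpower t s)%C.
Proof.
  intros Ht; rewrite !RCpower_polar.
  replace (Re (s + 1)) with (Re s + 1) by reflexivity.
  replace (Im (s + 1)) with (Im s) by (destruct s; simpl; ring).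
  replace ((Re s + 1) * ln t) with (ln t + Re s * ln t) by ring.
  rewrite exp_plus, exp_ln by assumption.
  unfold Cmult; simpl; f_equal; ring.
Qed.

Lemma RCpower_1 (t : R) : 0 < t -> RCpower t 1 = RtoC t.
Proof.
  intros Ht; rewrite RCpower_polar; simpl.
  rewrite Rmult_1_l, Rmult_0_l, exp_ln, cos_0, sin_0 by assumption.
  unfold RtoC; f_equal; ring.
Qed.

Lemma Gamma_int_correct (s : C) : 0 < Re s ->
  is_CInt_0_infty (fun t => (RtoC (exp (- t)) * RCpower t (s - 1))%C) (Gamma_int s).
Proof.
  intros Hs.
  destruct (ex_RInt_gen_weighted_RCpower (fun t => exp (- t)) s Hs) as [l Hl].
  - intros t _; apply (ex_derive_continuous (V := R_NormedModule)); auto_derive; trivial.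
  - intros t _; rewrite Rabs_pos_eq; [apply Rle_refl | left; apply exp_pos].
  - unfold Gamma_int; rewrite (CInt_0_infty_unique _ l Hl); exact Hl.
Qed.

Lemma filterlim_exp_neg_Rpower_0 (x : R) : 0 < x ->
  filterlim (fun t => exp (- t) * exp (x * ln t)) (at_right 0) (locally 0).
Proof.
  intros Hx.
  apply (filterlim_le_le (fun _ => 0) _ (fun t => exp (x * ln t)) 0).
  - exists (mkposreal 1 Rlt_0_1); intros t _ Ht.
    assert (H := exp_pos (x * ln t)); assert (H0 := exp_pos (- t)).
    assert (exp (- t) <= 1) by (rewrite <- exp_0; left; apply exp_increasing; lra).
    split; nra.
  - apply filterlim_const.
  - now apply filterlim_Rpower_0.
Qed.

Lemma filterlim_exp_neg_Rpower_p (x : R) : 0 < x ->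
  filterlim (fun t => exp (- t) * exp (x * ln t)) (Rbar_locally p_infty) (locally 0).
Proof.
  intros Hx.
  set (M := exp ((x + 1) * ln (x + 1) - (x + 1))).
  apply (filterlim_le_le (fun _ => 0) _ (fun t => M * / t) 0).
  - exists 0; intros t Ht.
    assert (H := exp_pos (x * ln t)); assert (H0 := exp_pos (- t)).
    split; [nra |].
    apply Rmult_le_reg_r with t; [exact Ht |].
    replace (M * / t * t) with M by (field; lra).
    replace (exp (- t) * exp (x * ln t) * t) with (exp (- t) * exp ((x + 1) * ln t)).
    + apply exp_neg_Rpower_bounded; lra.
    + replace ((x + 1) * ln t) with (x * ln t + ln t) by ring.
      rewrite exp_plus, exp_ln by exact Ht; ring.
  - apply filterlim_const.
  - assert (L : is_lim (fun t => M * / t) p_infty 0).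
    { evar_last.
      { apply is_lim_scal_l, is_lim_inv; [apply is_lim_id | easy]. }
      simpl; f_equal; ring. }
    exact L.
Qed.

Lemma filterlim_bounded_mult_0 (F : (R -> Prop) -> Prop) (FF : Filter F) (u v : R -> R) :
  (forall t, Rabs (v t) <= 1) -> filterlim u F (locally 0) ->
  filterlim (fun t => u t * v t) F (locally 0).
Proof.
  intros Hv Hu P [eps HP]; unfold filtermap.
  assert (Hu' := Hu (ball 0 eps) (locally_ball (T := R_UniformSpace) 0 eps));
    unfold filtermap in Hu'.
  revert Hu'; apply filter_imp; intros t Ht; apply HP.
  change (Rabs (u t * v t - 0) < eps).
  change (Rabs (u t - 0) < eps) in Ht.
  rewrite Rminus_0_r in *; rewrite Rabs_mult.
  assert (H := Rabs_pos (u t)); specialize (Hv t); nra.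
Qed.

Lemma is_RInt_gen_primitive_vanishing (F f : R -> R) :
  (forall t, 0 < t -> is_derive F t (f t)) ->
  (forall t, 0 < t -> continuous f t) ->
  filterlim F (at_right 0) (locally 0) ->
  filterlim F (Rbar_locally p_infty) (locally 0) ->
  is_RInt_gen f (at_right 0) (Rbar_locally p_infty) 0.
Proof.
  intros DF Cf L0 Lp.
  assert (Hmin : forall a b t, 0 < a -> 0 < b -> Rmin a b <= t -> 0 < t).
  { intros a b t Ha Hb Ht.
    assert (0 < Rmin a b) by (apply Rmin_case; assumption); lra. }
  apply is_RInt_gen_ext with (Derive F).
  { generalize filter_prod_pos; apply filter_imp; intros [a b] [Ha Hb] t Ht;
      simpl in *.
    apply is_derive_unique, DF, (Hmin a b); lra. }
  enough (H : is_RInt_gen (Derive F) (at_right 0) (Rbar_locally p_infty) (0 - 0))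
    by (rewrite Rminus_0_r in H; exact H).
  apply is_RInt_gen_Derive; try assumption.
  - generalize filter_prod_pos; apply filter_imp; intros [a b] [Ha Hb] t Ht;
      simpl in *.
    exists (f t); apply DF, (Hmin a b); lra.
  - generalize filter_prod_pos; apply filter_imp; intros [a b] [Ha Hb] t Ht;
      simpl in *.
    assert (H : 0 < t) by (apply (Hmin a b); lra).
    apply continuous_ext_loc with f; [| now apply Cf].
    exists (mkposreal t H); intros u Hu.
    symmetry; apply is_derive_unique, DF.
    change (Rabs (u - t) < t) in Hu; apply Rabs_def2 in Hu; lra.
Qed.

Lemma is_CInt_0_infty_pair (f : R -> C) (l1 l2 : R) :
  is_RInt_gen (fun t => Re (f t)) (at_right 0) (Rbar_locally p_infty) l1 ->
  is_RInt_gen (fun t => Im (f t)) (at_right 0) (Rbar_locally p_infty) l2 ->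
  is_CInt_0_infty f (l1, l2).
Proof.
  intros H1 H2; apply filterlimi_locally; intros eps.
  generalize (filter_and _ _ (proj1 (filterlimi_locally _ _) H1 eps)
    (proj1 (filterlimi_locally _ _) H2 eps)).
  apply filter_imp; intros [a b] [[x [Hx Bx]] [y [Hy By]]].
  exists (x, y); split; [| now split].
  now apply (is_RInt_fct_extend_pair (U := R_NormedModule) (V := R_NormedModule)).
Qed.

(** Integration by parts: the derivative of [- e^(-t) t^s] is
    [e^(-t) (t^s - s t^(s-1))], and this primitive vanishes at both ends. *)
Lemma Gamma_int_plus_1 (s : C) : 0 < Re s -> Gamma_int (s + 1) = (s * Gamma_int s)%C.
Proof.
  intros Hs.
  assert (H : is_CInt_0_infty
    (fun t => RtoC (exp (- t)) * (RCpower t s - s * RCpower t (s - 1)))%C 0).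
  { set (x := Re s); set (y := Im s).
    set (dRe := fun t => exp (- t) * exp (x * ln t) *
       ((1 - x / t) * cos (y * ln t) + y / t * sin (y * ln t))).
    set (dIm := fun t => exp (- t) * exp (x * ln t) *
       ((1 - x / t) * sin (y * ln t) - y / t * cos (y * ln t))).
    apply (is_CInt_0_infty_ext (fun t => (dRe t, dIm t))).
    { intros t Ht.
      assert (E : RCpower t (s - 1) = (RCpower t s * RtoC (/ t))%C).
      { replace (RCpower t s) with (RCpower t (s - 1 + 1)) by (f_equal; ring).
        rewrite RCpower_plus_1 by exact Ht.
        rewrite RtoC_inv by lra; field; intros E; apply RtoC_inj in E; lra. }
      rewrite E, RCpower_polar; unfold dRe, dIm, x, y; destruct s as [x0 y0].
      unfold Cmult, Cminus, Cplus, Copp, RtoC; simpl. f_equal; field; lra. }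
    apply is_CInt_0_infty_pair; simpl.
    - apply (is_RInt_gen_primitive_vanishing
               (fun t => exp (- t) * exp (x * ln t) * - cos (y * ln t))).
      + intros t Ht; unfold dRe; auto_derive; [lra | field; lra].
      + intros t Ht; apply (ex_derive_continuous (V := R_NormedModule)).
        unfold dRe; auto_derive; repeat split; lra.
      + apply filterlim_bounded_mult_0;
          [apply at_right_proper_filter | | now apply filterlim_exp_neg_Rpower_0].
        intros t; rewrite Rabs_Ropp; apply Rabs_le, COS_bound.
      + apply filterlim_bounded_mult_0;
          [apply Rbar_locally_filter | | now apply filterlim_exp_neg_Rpower_p].
        intros t; rewrite Rabs_Ropp; apply Rabs_le, COS_bound.
    - apply (is_RInt_gen_primitive_vanishing
               (fun t => exp (- t) * exp (x * ln t) * - sin (y * ln t))).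
      + intros t Ht; unfold dIm; auto_derive; [lra | field; lra].
      + intros t Ht; apply (ex_derive_continuous (V := R_NormedModule)).
        unfold dIm; auto_derive; repeat split; lra.
      + apply filterlim_bounded_mult_0;
          [apply at_right_proper_filter | | now apply filterlim_exp_neg_Rpower_0].
        intros t; rewrite Rabs_Ropp; apply Rabs_le, SIN_bound.
      + apply filterlim_bounded_mult_0;
          [apply Rbar_locally_filter | | now apply filterlim_exp_neg_Rpower_p].
        intros t; rewrite Rabs_Ropp; apply Rabs_le, SIN_bound. }
  apply CInt_0_infty_unique.
  replace (s * Gamma_int s)%C with (0 + s * Gamma_int s)%C by ring.
  eapply is_CInt_0_infty_ext;
    [| apply (is_CInt_0_infty_plus _ _ _ _ H
              (is_CInt_0_infty_scal s _ _ (Gamma_int_correct s Hs)))].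
  intros t _; simpl.
  replace (s + 1 - 1)%C with s by ring. ring.
Qed.

(** * The functional equation of the alternating Kurepa function *)

(** The two terms of the numerator are integrable separately: divided by
    [t + 1], each is a power of [t] times the weight [e^(-t) / (t + 1)], which is
    at most [e^(-t)]. *)
Lemma altKurepa_int_correct (z : C) : -1 < Re z ->
  is_CInt_0_infty (fun t => RtoC (exp (- t)) *
      ((RCpower t (z + 1) - m1_power z * RtoC t) / (RtoC t + 1)))%C
    (altKurepa_int z).
Proof.
  intros Hz.
  assert (Hk : forall s, 0 < Re s -> exists l, 
     is_CInt_0_infty (fun t => (RtoC (exp (- t) / (t + 1)) * RCpower t (s - 1))%C) l).
  { intros s Hs.
    apply (ex_RInt_gen_weighted_RCpower (fun t => exp (- t) / (t + 1)) s Hs).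
    - intros t Ht; apply (ex_derive_continuous (V := R_NormedModule)); auto_derive; lra.
    - intros t Ht; assert (H := exp_pos (- t)).
      assert (Hi : 0 < / (t + 1)) by (apply Rinv_0_lt_compat; lra).
      assert (/ (t + 1) <= 1) by (rewrite <- Rinv_1; apply Rinv_le_contravar; lra).
      unfold Rdiv; rewrite Rabs_pos_eq.
      + rewrite <- (Rmult_1_r (exp (- t))) at 2; apply Rmult_le_compat_l; lra.
      + left; now apply Rmult_lt_0_compat. }
  destruct (Hk (z + 1 + 1)%C) as [l1 H1]; [destruct z; simpl in *; lra |].
  destruct (Hk (RtoC 1 + 1)%C) as [l2 H2]; [simpl; lra |].
  assert (H := is_CInt_0_infty_plus _ _ _ _ H1
    (is_CInt_0_infty_scal (- m1_power z)%C _ _ H2)).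
  apply is_CInt_0_infty_ext with (g := (fun t => RtoC (exp (- t)) *
      ((RCpower t (z + 1) - m1_power z * RtoC t) / (RtoC t + 1)))%C) in H.
  - unfold altKurepa_int; rewrite (CInt_0_infty_unique _ _ H); exact H.
  - intros t Ht.
    assert (Ht1 : (RtoC t + 1)%C <> 0).
    { rewrite <- RtoC_plus; intros E; apply RtoC_inj in E; lra. }
    replace (z + 1 + 1 - 1)%C with (z + 1)%C by ring.
    replace (1 + 1 - 1)%C with (RtoC 1) by ring.
    rewrite RCpower_1 by exact Ht.
    rewrite RtoC_div, RtoC_plus by lra.
    field; exact Ht1.
Qed.

Lemma m1_power_plus_1 (z : C) : m1_power (z + 1) = (- m1_power z)%C.
Proof.
  unfold m1_power.
  replace (Ci * RtoC PI * (z + 1))%C with (Ci * RtoC PI * z + (0, PI))%C.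
  - unfold Cexp, Copp; generalize (Ci * RtoC PI * z)%C; intros [x y]; simpl.
    rewrite Rplus_0_r, neg_cos, neg_sin; f_equal; ring.
  - destruct z as [x y]; unfold Cmult, Cplus; simpl; f_equal; ring.
Qed.

(** The terms [(-1)^w t] and [(-1)^(w-1) t] cancel, and
    [t^(w+1) + t^w = (t + 1) t^w]. *)
Lemma altKurepa_int_functional (w : C) : 0 < Re w ->
  (altKurepa_int w + altKurepa_int (w - 1) = Gamma_int (w + 1))%C.
Proof.
  intros Hw; symmetry; apply CInt_0_infty_unique.
  assert (H1 : -1 < Re w) by lra.
  assert (H2 : -1 < Re (w - 1)) by (destruct w; simpl in *; lra).
  assert (H := is_CInt_0_infty_plus _ _ _ _ (altKurepa_int_correct w H1)
                 (altKurepa_int_correct (w - 1) H2)).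
  eapply is_CInt_0_infty_ext; [| exact H].
  intros t Ht; simpl.
  assert (Ht1 : (RtoC t + 1)%C <> 0).
  { rewrite <- RtoC_plus; intros E; apply RtoC_inj in E; lra. }
  replace (w - 1 + 1)%C with w by ring.
  replace (m1_power (w - 1)) with (- m1_power w)%C
    by (replace w with (w - 1 + 1)%C at 1 by ring;
        rewrite m1_power_plus_1; ring).
  replace (w + 1 - 1)%C with w by ring.
  rewrite RCpower_plus_1 by exact Ht.
  field; exact Ht1.
Qed.

(** * The functional equations in the whole plane *)

Lemma shift_right_pos (z : C) : 0 < Re z -> shift_right z = 0%nat.
Proof.
  intros H; unfold shift_right.
  assert (Hu : IZR (up (- Re z)) < 1) by (generalize (archimed (- Re z)); lra).
  apply lt_IZR in Hu; lia.
Qed.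

Lemma shift_right_nonpos (z : C) : Re z <= 0 ->
  shift_right z = S (shift_right (z + 1)).
Proof.
  intros H; unfold shift_right.
  destruct (archimed (- Re z)) as [H1 H2].
  replace (up (- Re (z + 1))) with (up (- Re z) - 1)%Z.
  - assert (Hu : 0 < IZR (up (- Re z))) by lra.
    apply lt_IZR in Hu; rewrite <- Z2Nat.inj_succ by lia; f_equal; lia.
  - apply tech_up; rewrite minus_IZR; destruct z; simpl in *; lra.
Qed.

Open Scope C_scope.

Lemma Gamma_plus_1 (z : C) : z <> 0 -> Gamma (z + 1) = z * Gamma z.
Proof.
  intros Hz; unfold Gamma.
  destruct (Rlt_dec 0 (Re z)) as [H | H].
  - rewrite !shift_right_pos by (destruct z; simpl in *; lra); simpl.
    now apply Gamma_int_plus_1.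
  - rewrite (shift_right_nonpos z) by lra; simpl; field; exact Hz.
Qed.

Lemma altKurepa_plus_1 (z : C) : altKurepa (z + 1) + altKurepa z = Gamma (z + 2).
Proof.
  destruct (Rlt_dec 0 (Re z)) as [H | H].
  - unfold altKurepa, Gamma; rewrite !shift_right_pos by (destruct z; simpl in *; lra); simpl.
    replace (altKurepa_int z) with (altKurepa_int (z + 1 - 1)) by (f_equal; ring).
    rewrite altKurepa_int_functional by (destruct z; simpl in *; lra).
    f_equal; ring.
  - unfold altKurepa; rewrite (shift_right_nonpos z) by lra; simpl; ring.
Qed.

(** * The rational functions *)

Lemma r_rec (n : nat) (z : C) :
  r (S (S (S n))) z =
    - ((z - RtoC (INR n) - 2) / (z - RtoC (INR n) - 1)) * r (S (S n)) z
    + 1 / (z - RtoC (INR n) - 1) * r (S n) z.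
Proof.
  transitivity (- ((z - RtoC (INR (S (S (S n)))) + 1)
                   / (z - RtoC (INR (S (S (S n)))) + 2)) * r (S (S n)) z
                + 1 / (z - RtoC (INR (S (S (S n)))) + 2) * r (S n) z); [reflexivity |].
  rewrite !S_INR, !RtoC_plus.
  replace (z - (RtoC (INR n) + 1 + 1 + 1) + 1) with (z - RtoC (INR n) - 2) by ring.
  replace (z - (RtoC (INR n) + 1 + 1 + 1) + 2) with (z - RtoC (INR n) - 1) by ring.
  reflexivity.
Qed.

Lemma q_rec (n : nat) (z : C) :
  q (S (S (S n))) z =
    - ((z - RtoC (INR n) - 2) / (z - RtoC (INR n) - 1)) * q (S (S n)) z
    + 1 / (z - RtoC (INR n) - 1) * q (S n) z.
Proof.
  transitivity (- ((z - RtoC (INR (S (S (S n)))) + 1)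
                   / (z - RtoC (INR (S (S (S n)))) + 2)) * q (S (S n)) z
                + 1 / (z - RtoC (INR (S (S (S n)))) + 2) * q (S n) z); [reflexivity |].
  rewrite !S_INR, !RtoC_plus.
  replace (z - (RtoC (INR n) + 1 + 1 + 1) + 1) with (z - RtoC (INR n) - 2) by ring.
  replace (z - (RtoC (INR n) + 1 + 1 + 1) + 2) with (z - RtoC (INR n) - 1) by ring.
  reflexivity.
Qed.

Lemma Csub_nz (z w : C) : z <> w -> z - w <> 0.
Proof.
  intros H E; apply H. replace z with (z - w + w) by ring; rewrite E; ring.
Qed.

Lemma denominator_nz (n : nat) (z : C) :
  z <> RtoC (INR (S n)) -> z - RtoC (INR n) - 1 <> 0.
Proof.
  intros H; apply Csub_nz in H; rewrite S_INR, RtoC_plus in H.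
  intros E; apply H; rewrite <- E; ring.
Qed.

(** The sequence [(-1)^n] solves the three-term recurrence of [q] and [r]:
    up to sign, the recurrence reads [(z - n + 1) + 1 = z - n + 2]. *)
Lemma q_plus_r (n : nat) (z : C) :
  z + 1 <> 0 -> (forall k, (k + 2 <= S n)%nat -> z <> RtoC (INR k)) ->
  q (S n) z + r (S n) z = RtoC (-1) ^ S n.
Proof.
  intros Hz1; induction n as [n IH] using (well_founded_induction Wf_nat.lt_wf).
  intros Hk; destruct n as [| [| n]].
  - simpl; field; exact Hz1.
  - assert (Hz : z <> 0) by (apply (Hk 0%nat); lia).
    unfold q, r; simpl Cpow; field; now split.
  - assert (H0 := IH n ltac:(lia) ltac:(intros k Hle; apply Hk; lia)).
    assert (H1 := IH (S n) ltac:(lia) ltac:(intros k Hle; apply Hk; lia)).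
    assert (Hd := denominator_nz n z (Hk (S n) ltac:(lia))).
    rewrite q_rec, r_rec.
    replace (r (S (S n)) z) with (RtoC (-1) ^ S (S n) - q (S (S n)) z)
      by (rewrite <- H1; ring).
    replace (r (S n) z) with (RtoC (-1) ^ S n - q (S n) z)
      by (rewrite <- H0; ring).
    rewrite !Cpow_S; field; exact Hd.
Qed.

(** Induction on [n]: the recurrence divides [r_(n+1) + r_n] by [z - n] at
    each step, and so does [Gamma] in passing from [z - n + 1] to [z - n]. *)
Lemma r_succ_plus_r_Gamma (n : nat) (z : C) :
  z + 1 <> 0 -> (forall k, (k <= n)%nat -> z <> RtoC (INR k)) ->
  (r (S (S n)) z + r (S n) z) * Gamma (z + 2) = - Gamma (z - RtoC (INR n)).
Proof.
  intros Hz1; induction n as [| n IH]; intros Hk.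
  - assert (Hz : z <> 0) by (apply (Hk 0%nat); lia).
    replace (z + 2) with (z + 1 + 1) by ring.
    rewrite (Gamma_plus_1 (z + 1) Hz1), (Gamma_plus_1 z Hz).
    replace (z - RtoC (INR 0)) with z by (simpl; ring).
    unfold r; field; now split.
  - assert (Hd := denominator_nz n z (Hk (S n) ltac:(lia))).
    replace (r (S (S (S n))) z + r (S (S n)) z)
      with ((r (S (S n)) z + r (S n) z) / (z - RtoC (INR n) - 1))
      by (rewrite r_rec; field; exact Hd).
    replace ((r (S (S n)) z + r (S n) z) / (z - RtoC (INR n) - 1) * Gamma (z + 2))
      with ((r (S (S n)) z + r (S n) z) * Gamma (z + 2) / (z - RtoC (INR n) - 1))
      by (field; exact Hd).
    rewrite IH by (intros k Hle; apply Hk; lia).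
    replace (z - RtoC (INR n)) with (z - RtoC (INR n) - 1 + 1) at 1 by ring.
    rewrite (Gamma_plus_1 _ Hd).
    replace (z - RtoC (INR (S n))) with (z - RtoC (INR n) - 1)
      by (rewrite S_INR, RtoC_plus; ring).
    field; exact Hd.
Qed.

Lemma altKurepa_reduction (n : nat) (z : C) :
  z + 1 <> 0 -> (forall k, (k + 2 <= S n)%nat -> z <> RtoC (INR k)) ->
  altKurepa z =
    RtoC (-1) ^ S n * (altKurepa (z - RtoC (INR (S n))) + r (S n) z * Gamma (z + 2)).
Proof.
  intros Hz1; induction n as [| n IH]; intros Hk.
  - assert (E := altKurepa_plus_1 (z - 1)).
    replace (z - 1 + 1) with z in E by ring.
    replace (z - 1 + 2) with (z + 1) in E by ring.
    simpl INR; replace (z + 2) with (z + 1 + 1) by ring.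
    rewrite (Gamma_plus_1 (z + 1) Hz1), <- E; simpl; field; exact Hz1.
  - rewrite IH by (intros k Hle; apply Hk; lia).
    assert (HG := r_succ_plus_r_Gamma n z Hz1 ltac:(intros k Hle; apply Hk; lia)).
    assert (E := altKurepa_plus_1 (z - RtoC (INR (S (S n))))).
    replace (z - RtoC (INR (S (S n))) + 1) with (z - RtoC (INR (S n))) in E
      by (rewrite (S_INR (S n)), RtoC_plus; ring).
    replace (z - RtoC (INR (S (S n))) + 2) with (z - RtoC (INR n)) in E
      by (rewrite !S_INR, !RtoC_plus; ring).
    replace (altKurepa (z - RtoC (INR (S n))))
      with (Gamma (z - RtoC (INR n)) - altKurepa (z - RtoC (INR (S (S n)))))
      by (rewrite <- E; ring).
    replace (Gamma (z - RtoC (INR n)))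
      with (- ((r (S (S n)) z + r (S n) z) * Gamma (z + 2)))
      by (rewrite HG; ring).
    rewrite (Cpow_S _ (S n)); ring.
Qed.

Theorem theorem3 (n : nat) (z : C)
  (hn : (1 <= n)%nat)
  (hneg : forall m : nat, (1 <= m)%nat -> z <> - RtoC (INR m))
  (hpos : forall k : nat, (k + 2 <= n)%nat -> z <> RtoC (INR k)) :
  altKurepa z =
    RtoC (-1) ^ n *
      (altKurepa (z - RtoC (INR n)) + (RtoC (-1) ^ n - q n z) * Gamma (z + 2))
  /\
  altKurepa z =
    RtoC (-1) ^ n *
      (altKurepa (z - RtoC (INR n)) + r n z * Gamma (z + 2)).
Proof.
  assert (Hz1 : z + 1 <> 0).
  { replace (z + 1) with (z - - RtoC (INR 1)) by (simpl; ring).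
    apply Csub_nz, hneg; lia. }
  destruct n as [| n]; [lia |].
  assert (Hr := altKurepa_reduction n z Hz1 hpos).
  split; [| exact Hr].
  rewrite <- (q_plus_r n z Hz1 hpos) at 2.
  replace (q (S n) z + r (S n) z - q (S n) z) with (r (S n) z) by ring.
  exact Hr.
Qed.
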